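(* Let $\mathfrak g$ be a finite-dimensional real vector space with a lattice $\mathfrak g_{\mathbb Z}\subset\mathfrak g$. Let $\Delta_1,\Delta_2\subseteq\mathfrak g^*$ be polytopes with $\Delta_1\cap\Delta_2\ne\emptyset$. (1) If both $\Delta_1$ and $\Delta_2$ are simple and they intersect relatively transversely, then $\Delta_1\cap\Delta_2$ is simple. (2) If both $\Delta_1$ and $\Delta_2$ are unimodular and they intersect integrally transversely, then $\Delta_1\cap\Delta_2$ is unimodular.
   Context: $\mathfrak g_{\mathbb Z}^*=\{\xi\in\mathfrak g^*\mid \xi(\mathfrak g_{\mathbb Z})\subseteq\mathbb Z\}$ is the dual lattice. A polyhedron $P\subseteq\mathfrak g^*$ is a finite intersection of affine closed half-spaces $\{\xi\mid\langle\xi,v_i\rangle\ge c_i\}$, $v_i\in\mathfrak g$, $c_i\in\mathbb R$; it is rational if the $v_i$ can be taken in $\mathfrak g_{\mathbb Z}$. A polytope is a bounded polyhedron. Polytopes need not be full-dimensional. For $\xi\in P$: $C_\xi P=\mathrm{Cone}(P-\xi)$ (conic hull) is the local cone; if $F$ is the unique face of $P$ containing $\xi$ in its relative interior, $L_\xi P=\mathrm{Span}_{\mathbb R}(F-\xi)$; $\mathrm{dir}(P)$ is the linear subspace of which the affine hull of $P$ is a translate. A polyhedral cone $C$ is simple if it is the conic hull of a basis of $\mathrm{dir}(C)$, and unimodular if it is rational and the conic hull of a $\mathbb Z$-basis of $\mathfrak g_{\mathbb Z}^*\cap\mathrm{dir}(C)$. A polytope $\Delta$ is simple if $C_\xi\Delta$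 is simple for all vertices $\xi$, and unimodular if it is rational and $C_\xi\Delta$ is unimodular for all vertices $\xi$. $\Delta_1$ and $\Delta_2$ intersect relatively transversely if $L_\xi\Delta_1+L_\xi\Delta_2=\mathrm{dir}(\Delta_1)+\mathrm{dir}(\Delta_2)$ for all $\xi\in\Delta_1\cap\Delta_2$. If both are rational, they intersect integrally transversely if for all $\xi\in\Delta_1\cap\Delta_2$ $$(L_\xi\Delta_1\cap\mathfrak g_{\mathbb Z}^* )+(L_\xi\Delta_2\cap\mathfrak g_{\mathbb Z}^* )=(\mathrm{dir}(\Delta_1)\cap\mathfrak g_{\mathbb Z}^* )+(\mathrm{dir}(\Delta_2)\cap\mathfrak g_{\mathbb Z}^* ).$$ *)

(* Defs.v *)
From HB Require Import structures.
From mathcomp Require Import all_boot all_order all_algebra.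
From mathcomp Require Import boolp classical_sets reals.

Set Implicit Arguments.
Unset Strict Implicit.
Unset Printing Implicit Defensive.

Import Order.TTheory GRing.Theory Num.Theory.
Local Open Scope classical_set_scope.
Local Open Scope ring_scope.

Section Hulls.
Variables (R : realType) (V : vectType R).
Implicit Types (A : set V) (U W : {vspace V}).

Definition translate A (p : V) : set V := [set x - p | x in A].

(* n = 0 is allowed, so the conic hull always contains 0. *)
Definition cone_hull A : set V :=
  [set y | exists n (t : 'I_n -> R) (x : 'I_n -> V),
     [/\ forall i, 0 <= t i, forall i, A (x i) & y = \sum_(i < n) t i *: x i]].

Definition aff_hull A : set V :=
  [set y | exists n (t : 'I_n -> R) (x : 'I_n -> V),
     [/\ \sum_(i < n) t i = 1, forall i, A (x i)
       & y = \sum_(i < n) t i *: x i]].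

(* The span of an arbitrary set; it exists by [span_setP] below. *)
Definition span_set A : {vspace V} :=
  xget 0%VS [set U : {vspace V} | A `<=` [set` U] /\
    forall W, A `<=` [set` W] -> (U <= W)%VS].

(* Meaningful for nonempty A only: see [dirP] below. *)
Definition dir A : {vspace V} :=
  xget 0%VS [set U : {vspace V} | exists p, aff_hull A = [set p + u | u in [set` U]]].

Lemma span_set_seq A : exists2 X : seq V,
  [set` X] `<=` A & A `<=` [set` <<X>>%VS].
Proof.
apply: contrapT => noX.
have big n : exists2 X : seq V, [set` X] `<=` A & (n <= \dim <<X>>%VS)%N.
  elim: n => [|n [X XA leX]]; first by exists [::].
  have /existsNP[a /not_implyP[Aa aX]] : ~ A `<=` [set` <<X>>%VS].
    by move=> AX; apply: noX; exists X.
  exists (a :: X) => [x /=|].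
    by rewrite inE => /predU1P[->|/XA].
  apply: (leq_ltn_trans leX).
  have sXaX : (<<X>> <= <<a :: X>>)%VS by rewrite span_cons addvSr.
  rewrite ltn_neqAle dimvS // andbT (dimv_leqif_eq sXaX).
  apply/negP => /eqP eqX; apply: aX => /=.
  by rewrite eqX memv_span ?mem_head.
have [X _] := big (\dim {:V}).+1.
by apply/negP; rewrite -leqNgt dimvS ?subvf.
Qed.

Lemma span_setP A : A `<=` [set` span_set A] /\
  forall W, A `<=` [set` W] -> (span_set A <= W)%VS.
Proof.
apply: (@xgetPex _ 0%VS [set U : {vspace V} | A `<=` [set` U] /\
  forall W, A `<=` [set` W] -> (U <= W)%VS]).
have [X XA AX] := span_set_seq A.
by exists <<X>>%VS; split => // W AW; apply/span_subvP => x /XA /AW.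
Qed.

Lemma dirP A : A !=set0 ->
  exists p, aff_hull A = [set p + u | u in [set` dir A]].
Proof.
move=> [p Ap].
apply: (@xgetPex _ 0%VS
  [set U : {vspace V} | exists p, aff_hull A = [set p + u | u in [set` U]]]).
have [X XA AX] := span_set_seq (translate A p).
exists <<X>>%VS, p; apply/seteqP; split=> y /=.
  move=> [n [t [x [t1 Ax ->]]]].
  exists (\sum_(i < n) t i *: (x i - p)); last first.
    rewrite -[X in X + _]scale1r -t1 scaler_suml -big_split /=.
    by apply: eq_bigr => i _; rewrite scalerBr addrC subrK.
  apply: memv_suml => i _; apply: memvZ; apply: AX; exists (x i) => //.
move=> [u /= Xu <-].
have uX : u = \sum_(i < size X) coord (in_tuple X) i u *: X`_i.
  exact: (@coord_span _ _ _ (in_tuple X)).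
have aX (i : 'I_(size X)) : exists2 a, A a & X`_i = a - p.
  by have [a Aa <-] := XA _ (mem_nth 0 (ltn_ord i)); exists a.
pose a i := projT1 (cid2 (aX i)).
have [Aa aE] : (forall i, A (a i)) /\ forall i : 'I_(size X), X`_i = a i - p.
  by split=> i; rewrite /a; case: cid2.
pose t (i : 'I_(size X)) : R := coord (in_tuple X) i u.
exists (size X).+1, (fun i => if unlift ord0 i is Some j then t j
                              else 1 - \sum_j t j),
  (fun i => if unlift ord0 i is Some j then a j else p); split.
- rewrite big_ord_recl unlift_none [X in _ + X](eq_bigr t) ?subrK// => i _.
  by rewrite liftK.
- by move=> i; case: unliftP.
- rewrite big_ord_recl unlift_none [X in _ = _ + X](eq_bigr (fun i => t i *: a i)).
    rewrite {1}uX scalerBl scale1r scaler_suml -addrA; congr (_ + _).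
    rewrite addrC -sumrB; apply: eq_bigr => i _.
    by rewrite aE scalerBr.
  by move=> i _; rewrite liftK.
Qed.

Definition zbasis n (L : set V) (X : n.-tuple V) : Prop :=
  L = [set v | inIntSpan X v] /\
  forall a : 'I_n -> int, \sum_(i < n) X`_i *~ a i = 0 -> forall i, a i = 0.

Definition is_lattice (L : set V) : Prop :=
  exists n (B : n.-tuple V), basis_of fullv B /\ L = [set v | inIntSpan B v].

End Hulls.

Section Polytopes.
Variables (R : realType) (g : vectType R).
Local Notation gd := 'Hom(g, R^o).
Implicit Types (P F C D : set gd) (xi : gd) (gZ : set g).

(* Sup norm of the coordinates with respect to some basis of g.  As all norms
   on the dual are equivalent, [bounded] and [relint] do not depend on it. *)
Definition dual_norm xi : R :=
  \big[Num.max/0]_(i < \dim {:g}) `|xi (vbasis {:g})`_i|.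

Definition dual_lattice gZ : set gd :=
  [set xi | forall v, gZ v -> xi v \is a Num.int].

Definition halfspaces (s : seq (g * R)) : set gd :=
  [set xi | forall vc, vc \in s -> vc.2 <= xi vc.1].

Definition polyhedron P : Prop := exists s, P = halfspaces s.

Definition rational gZ P : Prop :=
  exists2 s, forall vc, vc \in s -> gZ vc.1 & P = halfspaces s.

Definition bounded P : Prop := exists M, forall xi, P xi -> dual_norm xi <= M.

Definition polytope P : Prop := polyhedron P /\ bounded P.

(* v = 0 gives P itself (c = 0) and the empty set (c < 0). *)
Definition face P F : Prop :=
  exists v c, (forall xi, P xi -> c <= xi v) /\ F = P `&` [set xi | xi v = c].

Definition vertex P xi : Prop := face P [set xi].

Definition relint F : set gd :=
  [set xi | F xi /\ exists2 e, 0 < e &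
     forall eta, aff_hull F eta -> dual_norm (eta - xi) < e -> F eta].

(* The unique face containing xi in its relative interior. *)
Definition face_at P xi : set gd :=
  xget set0 [set F | face P F /\ relint F xi].

Definition local_cone P xi : set gd := cone_hull (translate P xi).

Definition local_lin P xi : {vspace gd} :=
  span_set (translate (face_at P xi) xi).

Definition simple_cone C : Prop :=
  polyhedron C /\
  exists2 X : seq gd, basis_of (dir C) X & C = cone_hull [set` X].

Definition lattice_in gZ (U : {vspace gd}) : set gd :=
  dual_lattice gZ `&` [set` U].

Definition unimodular_cone gZ C : Prop :=
  rational gZ C /\
  exists n (X : n.-tuple gd),
    zbasis (lattice_in gZ (dir C)) X /\ C = cone_hull [set` X].

Definition simple_polytope D : Prop :=
  polytope D /\ forall xi, vertex D xi -> simple_cone (local_cone D xi).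

Definition unimodular_polytope gZ D : Prop :=
  [/\ polytope D, rational gZ D
    & forall xi, vertex D xi -> unimodular_cone gZ (local_cone D xi)].

Definition relatively_transverse D1 D2 : Prop :=
  forall xi, (D1 `&` D2) xi ->
    (local_lin D1 xi + local_lin D2 xi)%VS = (dir D1 + dir D2)%VS.

Definition sumset (A B : set gd) : set gd :=
  [set x + y | x in A & y in B].

Definition integrally_transverse gZ D1 D2 : Prop :=
  forall xi, (D1 `&` D2) xi ->
    sumset (lattice_in gZ (local_lin D1 xi)) (lattice_in gZ (local_lin D2 xi))
    = sumset (lattice_in gZ (dir D1)) (lattice_in gZ (dir D2)).

End Polytopes.

(* Main.v *)
(* Near a point xi of a simple polytope the local cone is the sum of the tangent
   space of the face of xi and of a simplicial cone: take the generators of the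
   local cone at a vertex nu of that face, and split them according to whether
   or not they occur in the positive combination xi - nu.  At a vertex xi of
   D1 & D2 the two tangent spaces L1 and L2 meet in 0, and transversality moves
   every transverse generator of D1 along L1 into L2, and every one of D2 along
   L2 into L1.  The moved vectors are a basis of dir D1 & dir D2 generating the
   local cone of D1 & D2.  The same argument with lattice vectors and integral
   coefficients gives the unimodular case. *)
Require Import Defs.
From mathcomp Require Import all_boot all_order all_algebra.
From mathcomp Require Import boolp classical_sets reals.
From mathcomp Require Import ring lra.

Set Implicit Arguments.
Unset Strict Implicit.
Unset Printing Implicit Defensive.

Import Order.TTheory GRing.Theory Num.Theory.
Local Open Scope classical_set_scope.
Local Open Scope ring_scope.

(** * Integral combinations of a tuple *)

Lemma inIntSpan_nth (V : zmodType) n (X : n.-tuple V) (i : 'I_n) :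
  inIntSpan X X`_i.
Proof.
exists [ffun l => (l == i)%:R].
rewrite (bigD1 i) //= ffunE eqxx mulr1z big1 ?addr0 // => l /negPf li.
by rewrite ffunE li mulr0z.
Qed.

Lemma sum_intz (R : pzRingType) (V : lmodType R) n (X : n.-tuple V)
    (a : 'I_n -> int) :
  \sum_(i < n) X`_i *~ a i = \sum_(i < n) (a i)%:~R *: X`_i.
Proof. by apply: eq_bigr => i _; rewrite scaler_int. Qed.

(** * Conic hulls and frames *)

Section Hulls.
Variables (R : realType) (V : vectType R).
Implicit Types (A C : set V) (L U W : {vspace V}).

Lemma sub_cone_hull A : A `<=` cone_hull A.
Proof.
by move=> x Ax; exists 1%N, (fun=> 1), (fun=> x); split=> //;
  rewrite big_ord1 scale1r.
Qed.

Lemma cone_hull_vspace A U : A `<=` [set` U] -> cone_hull A `<=` [set` U].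
Proof.
move=> AU _ [n [t [x [_ Ax ->]]]]; apply: memv_suml => i _.
exact/memvZ/AU.
Qed.

Lemma span_set_eq A U :
  A `<=` [set` U] -> (forall W, A `<=` [set` W] -> (U <= W)%VS) ->
    span_set A = U.
Proof.
move=> AU minU; have [AS minS] := span_setP A.
by apply/eqP; rewrite eqEsubv minS // minU.
Qed.

(** Differences of points of the affine hull fill [dir A]. Since the weights sum to 1, subtracting
    [p] from such a point leaves a combination of vectors [a i - p]. *)
Lemma dirE A p : A p -> dir A = span_set (translate A p).
Proof.
move=> Ap; have [q Aq] := @dirP _ _ A (ex_intro _ p Ap).
have sub_aff : A `<=` aff_hull A.
  move=> x Ax; exists 1%N, (fun=> 1), (fun=> x).
  by split=> //; rewrite big_ord1 ?scale1r.
have dirB x y : aff_hull A x -> aff_hull A y -> x - y \in dir A.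
  rewrite Aq => -[u /= uU <-] [v /= vU <-].
  by rewrite opprD addrACA subrr add0r rpredB.
symmetry; apply: span_set_eq => [_ [x Ax <-]|W AW].
  by apply: dirB; apply: sub_aff.
apply/subvP => u uU.
have affW x : aff_hull A x -> x - p \in W.
  move=> [n [t [a [t1 Aa ->]]]].
  rewrite -[p in - p]scale1r -t1 scaler_suml -sumrB; apply: memv_suml => i _.
  by rewrite -scalerBr memvZ // AW //; exists (a i).
have qA : aff_hull A q by rewrite Aq; exists 0; rewrite /= ?mem0v ?addr0.
have quA : aff_hull A (q + u) by rewrite Aq; exists u.
suff -> : u = (q + u - p) - (q - p) by rewrite rpredB ?affW.
by rewrite opprB addrA subrK addrC addKr.
Qed.

Lemma dir_cone_hull A : dir (cone_hull A) = span_set A.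
Proof.
have C0 : cone_hull A 0.
  by exists 0%N, (fun=> 0), (fun=> 0); split=> [||];
    [case|case|rewrite big_ord0].
rewrite (dirE C0).
have [AS minS] := span_setP A.
apply: span_set_eq => [_ [x Cx <-]|W CW].
  by rewrite subr0; apply: (cone_hull_vspace AS).
apply: minS => x Ax; apply: CW; exists x; last by rewrite subr0.
exact: sub_cone_hull.
Qed.

Lemma dir_local_cone A p : A p -> dir (cone_hull (translate A p)) = dir A.
Proof. by move=> Ap; rewrite dir_cone_hull (dirE Ap). Qed.

Lemma span_set_span (X : seq V) : span_set [set` X] = <<X>>%VS.
Proof.
apply: span_set_eq => [x /= xX|W XW]; first exact: memv_span.
exact/span_subvP.
Qed.

Lemma span_set_lincomb A x : x \in span_set A ->
  exists n (t : 'I_n -> R) (a : 'I_n -> V),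
    (forall i, A (a i)) /\ x = \sum_(i < n) t i *: a i.
Proof.
have [X XA /(proj2 (span_setP A)) /subvP AX] := span_set_seq A.
move=> /AX xX; exists (size X), (fun i => coord (in_tuple X) i x),
  (fun i => X`_i).
split=> [i|]; first by apply: XA; rewrite /= mem_nth.
exact: (coord_span (X := in_tuple X)).
Qed.

(** Combinations in [cone_hull] may repeat vectors in any order; here they are collected into one
    coefficient per index of [X]. *)
Lemma cone_hull_tuple n (X : n.-tuple V) x :
  cone_hull [set` X] x <->
  exists2 c : 'I_n -> R, (forall i, 0 <= c i) & x = \sum_(i < n) c i *: X`_i.
Proof.
split=> [[m [t [y [t0 yX ->]]]]|[c c0 ->]]; last first.
  exists n, c, (fun i => X`_i); split=> // i /=.
  by rewrite mem_nth // size_tuple.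
elim/big_ind: _ => [|u v [c c0 ->] [d d0 ->]|i _].
- by exists (fun=> 0) => //; rewrite big1 // => i _; rewrite scale0r.
- exists (fun i => c i + d i) => [i|]; first by rewrite addr_ge0.
  by rewrite -big_split /=; apply: eq_bigr => i _; rewrite scalerDl.
- have /tnthP[j ->] := yX i; exists (fun k => if k == j then t i else 0).
    by move=> k; case: eqP.
  rewrite (bigD1 j) //= eqxx big1 ?addr0 ?(tnth_nth 0)// => k /negPf ->.
  by rewrite scale0r.
Qed.

(* With [Lam] and [K] everything, [frame_lat] and [frame_coef] are void, which
   serves the simple case; with [Lam] the dual lattice and [K] the integers, [e]
   is a Z-basis modulo [L] of the lattice points of [L + <<e>>]. *)
Record frame (Lam : set V) (K : set R) (C : set V) (U L : {vspace V})
    (J : finType) (e : J -> V) : Prop := Frame {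
  frame_cone : forall x, C x <->
    exists2 c : J -> R, (forall j, 0 <= c j) & x - \sum_j c j *: e j \in L;
  frame_dir : forall j, e j \in U;
  frame_lat : forall j, Lam (e j);
  frame_free : forall c : J -> R, \sum_j c j *: e j \in L -> forall j, c j = 0;
  frame_coef : forall (c : J -> R) x, Lam x -> x - \sum_j c j *: e j \in L ->
    forall j, K (c j) }.

Section Intersection.
Variables (Lam : set V) (K : set R) (C1 C2 : set V) (U1 U2 L1 L2 : {vspace V}).
Variables (J1 J2 : finType) (e1 : J1 -> V) (e2 : J2 -> V).
Hypothesis LamB : forall x y, Lam x -> Lam y -> Lam (x - y).
Hypotheses (F1 : frame Lam K C1 U1 L1 e1) (F2 : frame Lam K C2 U2 L2 e2).
Hypothesis L12 : (L1 :&: L2 = 0)%VS.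
Hypothesis transverse : forall x, Lam x -> x \in U1 \/ x \in U2 ->
  exists l, [/\ Lam l, l \in L1 & x - l \in L2].

(* Transversality moves [e1 j] along [L1] into [L2], and [e2 j] along [L2] into
   [L1]; the moved vectors generate the intersection. *)
Lemma frame_setI :
  exists (J : finType) (w : J -> V), frame Lam K (C1 `&` C2) fullv 0 w.
Proof.
have ex1 j : exists w, [/\ Lam w, e1 j - w \in L1 & w \in L2].
  have [l [Ll lL1 lL2]] :=
    transverse (frame_lat F1 j) (or_introl (frame_dir F1 j)).
  exists (e1 j - l); split=> //; first exact/LamB/Ll/(frame_lat F1).
  by rewrite subKr.
have ex2 j : exists w, [/\ Lam w, w \in L1 & e2 j - w \in L2].
  exact: transverse (frame_lat F2 j) (or_intror (frame_dir F2 j)).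
have [w1 w1P] := choice ex1; have [w2 w2P] := choice ex2.
pose w (j : J1 + J2) := match j with inl a => w1 a | inr b => w2 b end.
have sumw (c : J1 + J2 -> R) : \sum_j c j *: w j =
    \sum_j c (inl j) *: w1 j + \sum_j c (inr j) *: w2 j by rewrite big_sumType.
(* Modulo [L1] each [w1 j] equals [e1 j] and each [w2 j] vanishes, so only the [inl] coefficients
   count. *)
have mod1 (c : J1 + J2 -> R) x : (x - \sum_j c j *: w j \in L1) =
    (x - \sum_j c (inl j) *: e1 j \in L1).
  rewrite sumw; set S := \sum_j c (inl j) *: e1 j.
  have -> : x - (\sum_j c (inl j) *: w1 j + \sum_j c (inr j) *: w2 j) =
     (x - S) + (\sum_j c (inl j) *: (e1 j - w1 j) - \sum_j c (inr j) *: w2 j).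
    rewrite [X in _ + (X - _)](eq_bigr (fun j => c (inl j) *: e1 j - c (inl j) *: w1 j)).
      by rewrite sumrB -/S !addrA subrK opprD addrA.
    by move=> j _; rewrite scalerBr.
  rewrite rpredDr // rpredB // rpred_sum // => j _; apply: memvZ.
    by case: (w1P j).
  by case: (w2P j).
have mod2 (c : J1 + J2 -> R) x : (x - \sum_j c j *: w j \in L2) =
    (x - \sum_j c (inr j) *: e2 j \in L2).
  rewrite sumw; set S := \sum_j c (inr j) *: e2 j.
  have -> : x - (\sum_j c (inl j) *: w1 j + \sum_j c (inr j) *: w2 j) =
     (x - S) + (\sum_j c (inr j) *: (e2 j - w2 j) - \sum_j c (inl j) *: w1 j).
    rewrite [X in _ + (X - _)](eq_bigr (fun j => c (inr j) *: e2 j - c (inr j) *: w2 j)).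
      by rewrite sumrB -/S !addrA subrK opprD addrA addrAC.
    by move=> j _; rewrite scalerBr.
  rewrite rpredDr // rpredB // rpred_sum // => j _; apply: memvZ.
    by case: (w2P j).
  by case: (w1P j).
exists (J1 + J2)%type, w; split=> [x|j|j|c|c x Lx].
- split=> [[/(frame_cone F1)[a a0 xa] /(frame_cone F2)[b b0 xb]]|[c c0]].
    exists (fun j => match j with inl i => a i | inr i => b i end) => [[]//|].
    (* As [L1] and [L2] meet in 0, an equality can be checked modulo each of them separately; the
       coefficients of the two cones thus form one family. *)
    rewrite -L12 memv_cap; apply/andP; split.
      by rewrite (mod1 (fun j => match j with inl i => a i | inr i => b i end)).
    by rewrite (mod2 (fun j => match j with inl i => a i | inr i => b i end)).
  rewrite -L12 memv_cap mod1 mod2 => /andP[x1 x2]; split.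
    by apply/(frame_cone F1); exists (fun j => c (inl j)).
  by apply/(frame_cone F2); exists (fun j => c (inr j)).
- exact: memvf.
- by case: j => j /=; [case: (w1P j)|case: (w2P j)].
- rewrite -memvN -[- _]add0r -L12 memv_cap mod1 mod2 !add0r !memvN => /andP[x1 x2].
  by case=> j; [have := frame_free F1 x1 j|have := frame_free F2 x2 j].
- rewrite -L12 memv_cap mod1 mod2 => /andP[x1 x2].
  by case=> j; [have := frame_coef F1 Lx x1 j|have := frame_coef F2 Lx x2 j].
Qed.

End Intersection.

(** Common form of the simple and unimodular cases: with [setT] twice, linearly independent
    generators; with the dual lattice and the integers, generators that are also a Z-basis of the
    lattice points in the span of [C]. *)
Definition adapted_basis (Lam : set V) (K : set R) C n (X : n.-tuple V) : Prop :=
  [/\ C = cone_hull [set` X], free X, forall i : 'I_n, Lam X`_i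
    & forall c : 'I_n -> R, Lam (\sum_(i < n) c i *: X`_i) -> forall i,
      K (c i)].

(** With tangent space 0 the congruences of a frame become equalities. *)
Lemma frame_adapted_basis Lam K C U (J : finType) (w : J -> V) :
  frame Lam K C U 0 w -> adapted_basis Lam K C (codom_tuple w).
Proof.
move=> F.
have nthw (i : 'I_#|J|) : (codom_tuple w)`_i = w (enum_val i).
  by rewrite (nth_map (enum_val i)) -?cardE // -enum_val_nth.
have sumw (c : 'I_#|J| -> R) :
    \sum_(i < #|J|) c i *: (codom_tuple w)`_i = \sum_j c (enum_rank j) *: w j.
  rewrite [RHS](reindex _ (onW_bij _ (enum_val_bij J))) /=.
  by apply: eq_bigr => i _; rewrite nthw enum_valK.
split.
- apply/seteqP; split=> x.
    move=> /(frame_cone F)[c c0]; rewrite memv0 subr_eq0 => /eqP ->.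
    apply/cone_hull_tuple; exists (fun i => c (enum_val i)) => //.
    by rewrite sumw; apply: eq_bigr => j _; rewrite enum_rankK.
  move=> /cone_hull_tuple[c c0 ->]; apply/(frame_cone F).
  by exists (fun j => c (enum_rank j)) => //; rewrite sumw subrr mem0v.
- apply/freeP => c; rewrite sumw => /eqP;
  rewrite -memv0 => /(frame_free F) c0 i.
  by have := c0 (enum_val i); rewrite enum_valK.
- by move=> i; rewrite nthw; apply: frame_lat F _.
- move=> c Lc i; rewrite -[i]enum_valK.
  have := frame_coef F (c := fun j => c (enum_rank j)) Lc; apply.
  by rewrite sumw subrr mem0v.
Qed.

End Hulls.

(** * Polyhedra *)

Section Polyhedra.
Variables (R : realType) (g : vectType R).
Local Notation gd := 'Hom(g, R^o).
Implicit Types (s : seq (g * R)) (x xi nu : gd) (v : g).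

(** * Evaluation of functionals and the dual norm *)

Lemma scale_evalE (a : R) x v : (a *: x) v = a * (x v : R).
Proof. by rewrite scale_lfunE. Qed.

Lemma line_evalE xi (t : R) x v : (xi + t *: x) v = (xi v : R) + t * (x v : R).
Proof. by rewrite add_lfunE scale_lfunE. Qed.

Lemma sub_evalE x xi v : (x - xi) v = (x v : R) - (xi v : R).
Proof. by rewrite add_lfunE opp_lfunE. Qed.

Lemma eval_sum_seq (T : Type) (r : seq T) x (F : T -> g) :
  x (\sum_(i <- r) F i) = \sum_(i <- r) (x (F i) : R).
Proof. by rewrite linear_sum. Qed.

Lemma dual_norm_ge0 x : 0 <= dual_norm x.
Proof. exact: bigmax_ge_id. Qed.

Lemma le_dual_norm x (i : 'I_(\dim {:g})) : `|(x (vbasis {:g})`_i : R)| <= dual_norm x.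
Proof. exact: (le_bigmax 0 (fun i : 'I_(\dim {:g}) => `|(x (vbasis {:g})`_i : R)|)). Qed.

Lemma eval_lincomb x n (c : 'I_n -> R) (b : 'I_n -> g) :
  x (\sum_(i < n) c i *: b i) = \sum_(i < n) c i * (x (b i) : R).
Proof. by rewrite linear_sum; apply: eq_bigr => i _; rewrite linearZ. Qed.

Lemma dual_norm_le0 x : dual_norm x <= 0 -> x = 0.
Proof.
move=> x0; apply/lfunP => v;
  rewrite zero_lfunE (coord_vbasis (memvf v)) eval_lincomb big1 // => i _.
suff /eqP -> : (x (vbasis {:g})`_i : R) == 0 by rewrite mulr0.
by rewrite -normr_le0; apply: le_trans (le_dual_norm x i) x0.
Qed.

Lemma eval_le_dual_norm v :
  exists2 k : R, 0 < k & forall x, `|(x v : R)| <= k * dual_norm x.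
Proof.
(* The summand 1 keeps the constant positive when [v = 0]. *)
exists (1 + \sum_i `|coord (vbasis {:g}) i v|) => [|x].
  by rewrite ltr_pwDl ?sumr_ge0.
rewrite {1}(coord_vbasis (memvf v)) eval_lincomb mulrDl mul1r ler_wpDl ?dual_norm_ge0 //.
rewrite mulr_suml; apply: le_trans (ler_norm_sum _ _ _) _.
apply: ler_sum => i _; rewrite normrM.
by rewrite ler_wpM2l ?le_dual_norm.
Qed.

Lemma dual_normZ_le (t : R) x : dual_norm (t *: x) <= `|t| * dual_norm x.
Proof.
apply: bigmax_le => [|i _]; first by rewrite mulr_ge0 ?dual_norm_ge0.
by rewrite scale_evalE normrM ler_wpM2l ?le_dual_norm.
Qed.

Lemma dual_norm_small x (e : R) : 0 < e -> exists2 t : R, 0 < t &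
  dual_norm (t *: x) < e.
Proof.
move=> e0; have d0 := dual_norm_ge0 x; have d1 : 0 < dual_norm x + 1 by lra.
exists (e / (dual_norm x + 1)); first exact: divr_gt0.
apply: le_lt_trans (dual_normZ_le _ _) _.
rewrite ger0_norm ?divr_ge0 ?ltW // mulrAC ltr_pdivrMr // ltr_pM2l //; lra.
Qed.

(** Makes the radii of finitely many constraints uniform by taking their minimum; asking for [Q] on
    a whole interval from 0 is what lets a radius shrink. *)
Lemma seq_common_radius (T : eqType) (s : seq T) (Q : T -> R -> Prop) :
  (forall a, a \in s -> exists2 t : R, 0 < t & forall t', 0 <= t' <= t ->
    Q a t') ->
  exists2 t : R, 0 < t & forall a, a \in s -> forall t', 0 <= t' <= t -> Q a t'.
Proof.
elim: s => [|a s IH] sQ; first by exists 1.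
have [t t0 tQ] := sQ a (mem_head _ _).
have [|u u0 uQ] := IH; first by move=> b bs; apply: sQ; rewrite inE bs orbT.
exists (Num.min t u); first by rewrite lt_min t0.
move=> b; rewrite inE => /predU1P[->|bs] t' /andP[t'0];
  rewrite le_min => /andP[tt ut].
  by apply: tQ; rewrite t'0.
by apply: uQ => //; rewrite t'0.
Qed.

(** * Active constraints, local cones, faces and vertices *)

Definition active s xi (vc : g * R) : bool :=
  (vc \in s) && (xi vc.1 == vc.2 :> R).

(** Along [x] an active constraint does not decrease, and an idle one has positive slack that a
    short step cannot exhaust. *)
Lemma line_in_halfspaces s xi x : halfspaces s xi ->
  (forall vc, active s xi vc -> 0 <= (x vc.1 : R)) ->
  exists2 t : R, 0 < t & forall t', 0 <= t' <= t -> halfspaces s (xi + t' *: x).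
Proof.
move=> sxi xpos.
have [|t t0 tP] := @seq_common_radius _ s
  (fun vc t => vc.2 <= (xi + t *: x) vc.1 :> R).
  move=> vc vcs; have := sxi vc vcs; rewrite le_eqVlt => /orP[/eqP xivc|xivc].
    exists 1 => // t' /andP[t'0 _];
      rewrite line_evalE -xivc lerDl mulr_ge0 // xpos //.
    by rewrite /active vcs -xivc eqxx.
  have n0 := normr_ge0 (x vc.1 : R).
  have d0 : 0 < (xi vc.1 : R) - vc.2 by rewrite subr_gt0.
  (* Slack over speed; the added 1 prevents division by 0. *)
  exists (((xi vc.1 : R) - vc.2) / (`|(x vc.1 : R)| + 1)); first
    by rewrite divr_gt0 //; lra.
  move=> t' /andP[t'0]; rewrite ler_pdivlMr; last lra.
  rewrite line_evalE; have := ler_norm (- (x vc.1 : R)); rewrite normrN => xn.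
  have := ler_wpM2l t'0 xn; lra.
by exists t => // t' tt' vc vcs; apply: tP.
Qed.

(** Each [eta - xi] is nonnegative on the active normals. Conversely a short step [t *: x] stays in
    the polyhedron, and dividing by [t] gives [x] as a one-term conic combination. *)
Lemma local_cone_halfspaces s xi : halfspaces s xi ->
  local_cone (halfspaces s) xi =
  [set x | forall vc, active s xi vc -> 0 <= (x vc.1 : R)].
Proof.
move=> sxi; apply/seteqP;
  split=> [_ [n [t [y [t0 yP ->]]]] vc /andP[vcs /eqP xivc]|x /= xpos].
  rewrite sum_lfunE; apply: sumr_ge0 => i _.
  have [eta /(_ vc vcs) eta_vc <-] := yP i.
  by rewrite scale_evalE mulr_ge0 // sub_evalE subr_ge0 xivc.
have [t t0 /(_ t)] := line_in_halfspaces sxi xpos.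
rewrite lexx ltW // => /(_ isT) sx.
exists 1%N, (fun=> t^-1), (fun=> t *: x); split=> [_|_|].
- by rewrite invr_ge0 ltW.
- by exists (xi + t *: x) => //; rewrite addrC addKr.
- by rewrite big_ord1 scalerA mulVf ?scale1r ?gt_eqF.
Qed.

(** Presents the local cone by the active normals with bounds 0, so that polyhedrality and
    rationality pass to it. *)
Lemma local_cone_halfspacesE s xi : halfspaces s xi ->
  local_cone (halfspaces s) xi =
  halfspaces [seq (vc.1, 0) | vc <- s & xi vc.1 == vc.2 :> R].
Proof.
move=> sxi; rewrite local_cone_halfspaces //; apply/seteqP; split=> x /= xpos.
  by move=> p /mapP[vc]; rewrite mem_filter andbC => vcA -> /=; apply: xpos.
move=> vc; rewrite /active andbC => vcA.
by apply: (xpos (vc.1, 0)); apply: map_f; rewrite mem_filter.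
Qed.

(** The sum of the active constraints supports this face: each term is at least its bound, so the
    sum is tight only where all terms are. *)
Lemma face_active s xi : halfspaces s xi ->
  face (halfspaces s)
    [set eta | halfspaces s eta /\ forall vc, active s xi vc ->
      eta vc.1 = vc.2 :> R].
Proof.
move=> sxi; pose a := [seq vc <- s | xi vc.1 == vc.2 :> R].
have aP vc : (vc \in a) = active s xi vc by rewrite mem_filter andbC.
exists (\sum_(vc <- a) vc.1), (\sum_(vc <- a) vc.2).
have ge_a eta : halfspaces s eta -> forall vc, vc \in a ->
  vc.2 <= (eta vc.1 : R).
  by move=> seta vc; rewrite aP => /andP[/seta].
split=> [eta seta|].
  by rewrite eval_sum_seq big_seq [leRHS]big_seq;
    apply: ler_sum => vc /(ge_a _ seta).
apply/seteqP; split=> eta [seta etaA]; split=> //=.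
  by rewrite eval_sum_seq; apply: eq_big_seq => vc; rewrite aP => /etaA.
move=> vc; rewrite -aP => vca; apply/eqP; rewrite -subr_eq0; apply/eqP.
have /eqP : \sum_(vc <- a) ((eta vc.1 : R) - vc.2) = 0.
  by rewrite sumrB -eval_sum_seq etaA subrr.
rewrite big_seq psumr_eq0 => [/allP/(_ vc vca)|wd /(ge_a _ seta)].
  by rewrite vca => /eqP.
by rewrite subr_ge0.
Qed.

Lemma vertex_active s nu : halfspaces s nu ->
  (forall x, (forall vc, active s nu vc -> x vc.1 = 0 :> R) -> x = 0) ->
  vertex (halfspaces s) nu.
Proof.
move=> snu nu0; rewrite /vertex.
suff -> : [set nu] = [set eta | halfspaces s eta /\
    forall vc, active s nu vc -> eta vc.1 = vc.2 :> R] by exact: face_active.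
apply/seteqP; split=> [_ ->|eta [_ etaA] /=].
  by split=> // vc /andP[_ /eqP].
apply/eqP; rewrite -subr_eq0; apply/eqP/nu0 => vc vcA.
by rewrite sub_evalE etaA //; case/andP: vcA => _ /eqP ->; rewrite subrr.
Qed.

(** Short steps along [x] and [- x] are both feasible, and the functional supporting [F] is minimal
    at [xi], so it is constant along [x]. *)
Lemma line_in_face s xi x F : halfspaces s xi -> face (halfspaces s) F ->
  F xi ->
  (forall vc, active s xi vc -> x vc.1 = 0 :> R) ->
  exists2 t : R, 0 < t & F (xi + t *: x).
Proof.
move=> sxi [v [c [cle ->]]] [_ /= xiv] xA.
have [|t t0 /(_ t)] := line_in_halfspaces sxi (x := x); first
  by move=> vc /xA ->.
rewrite lexx ltW // => /(_ isT) sp.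
have [|u u0 /(_ u)] := line_in_halfspaces sxi (x := - x).
  by move=> vc /xA xvc; rewrite opp_lfunE xvc oppr0.
rewrite lexx ltW // => /(_ isT) sm.
have xv : (x v : R) = 0.
  have := cle _ sp; have := cle _ sm;
    rewrite !line_evalE opp_lfunE xiv => h1 h2.
  have h3 : 0 <= t * (x v : R) by lra.
  have h4 : 0 <= u * - (x v : R) by lra.
  move: h3 h4; rewrite !pmulr_rge0 // oppr_ge0 => h3 h4.
  by apply/eqP; rewrite eq_le h3 h4.
by exists t => //; split=> //=; rewrite line_evalE xv mulr0 addr0.
Qed.

Lemma vertex_lineality s nu x : halfspaces s nu -> vertex (halfspaces s) nu ->
  (forall vc, active s nu vc -> x vc.1 = 0 :> R) -> x = 0.
Proof.
move=> snu vnu xA; have [|t t0] := line_in_face snu vnu _ xA; first by [].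
move=> /= /(congr1 (fun y => y - nu)); rewrite addrC addKr subrr => /eqP.
by rewrite scaler_eq0 gt_eqF //= => /eqP.
Qed.

(** Otherwise the whole ray from [xi] along [x] would be feasible, yet some coordinate of it is
    unbounded. *)
Lemma bounded_line_exit s xi x : halfspaces s xi -> bounded (halfspaces s) ->
  x != 0 ->
  exists2 vc, vc \in s & (x vc.1 : R) < 0.
Proof.
move=> sxi [M bM] x0; apply: contrapT => noexit.
have line t : 0 <= t -> halfspaces s (xi + t *: x).
  move=> t0 vc vcs; rewrite line_evalE.
  apply: le_trans (sxi vc vcs) _; rewrite lerDl mulr_ge0 // leNgt;
    apply/negP => xvc.
  by apply: noexit; exists vc.
move/negP: x0; apply; apply/eqP/dual_norm_le0/bigmax_le => // i _.
rewrite leNgt; apply/negP; set b := (vbasis {:g})`_i => xb0.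
have M0 : `|(xi b : R)| <= M by apply: le_trans (le_dual_norm xi i) (bM _ sxi).
have nx0 := normr_ge0 (xi b : R).
(* At this parameter the value at [b] has moved by [2 M + 1] from one of size at most [M], so its
   size exceeds [M]. *)
have t0 : 0 <= (M + M + 1) / `|(x b : R)| by rewrite divr_ge0 //; lra.
have := le_trans (le_dual_norm _ i) (bM _ (line _ t0)); rewrite -/b line_evalE.
rewrite addrC leNgt; move/negP; apply; apply: lt_le_trans (lerB_normD _ _).
rewrite normrM (ger0_norm t0) divfK ?gt_eqF //; lra.
Qed.

(* If [xi] is not a vertex, move along a line on which the active constraints
   stay constant until a new constraint becomes active. *)
Lemma exists_vertex s xi : halfspaces s xi -> bounded (halfspaces s) ->
  exists nu, [/\ halfspaces s nu, vertex (halfspaces s) nu &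
    forall vc, active s xi vc -> active s nu vc].
Proof.
(* The induction is on the number of constraints that are not tight. *)
move=> sxi bs; pose idle eta := [seq vc <- s | eta vc.1 != vc.2 :> R].
have [n] := ubnP (size (idle xi)); elim: n xi sxi => // n IHn xi sxi ltn.
have [xi0|] := pselect (forall x, (forall vc, active s xi vc ->
  x vc.1 = 0 :> R) -> x = 0).
  by exists xi; split=> //; apply: vertex_active.
move=> /existsNP[x /not_implyP[xA /eqP x0]].
have [wd wds xwd] := bounded_line_exit sxi bs x0.
(* The parameter at which the line becomes tight for [vc]; its minimum over the decreasing
   constraints is the longest feasible step. *)
pose ratio (vc : g * R) : R := ((xi vc.1 : R) - vc.2) / - (x vc.1 : R).
pose neg (i : 'I_(size s)) := ((x (tnth (in_tuple s) i).1 : R) < 0).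
have /tnthP[i0 wdE] : wd \in in_tuple s by [].
have neg0 : neg i0 by rewrite /neg -wdE.
case: (arg_minP (fun i => ratio (tnth (in_tuple s) i)) neg0) => i negi mini.
set vc := tnth (in_tuple s) i in mini; have vcs : vc \in s :=
  mem_tnth i (in_tuple s).
have xvc : (x vc.1 : R) < 0 := negi.
pose t := ratio vc.
have t0 : 0 <= t by rewrite divr_ge0 ?subr_ge0 ?sxi // oppr_ge0 ltW.
have seta : halfspaces s (xi + t *: x).
  move=> ab abs; rewrite line_evalE; have [xab|xab] := ltP (x ab.1 : R) 0;
    last first.
    by apply: le_trans (sxi ab abs) _; rewrite lerDl mulr_ge0.
  have /tnthP[k abE] : ab \in in_tuple s by [].
  have := mini k; rewrite /neg -abE => /(_ xab);
    rewrite -/t /ratio ler_pdivlMr ?oppr_gt0 //; lra.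
have actI ab : active s xi ab -> active s (xi + t *: x) ab.
  move=> abA; case/andP: (abA) => abs xiab.
  by rewrite /active abs line_evalE (xA ab) // mulr0 addr0.
have vc_eta : (xi + t *: x) vc.1 = vc.2 :> R.
  have tE : t * - (x vc.1 : R) = (xi vc.1 : R) - vc.2
    by rewrite divfK // oppr_eq0 lt_eqF.
  by rewrite line_evalE; lra.
have [|nu [snu vnu nuA]] := IHn _ seta.
  rewrite -ltnS; apply: leq_trans ltn; rewrite ltnS.
  (* Tight constraints stay tight, so the new idle list filters the old one. It loses [vc], which
     was idle because [x] is nonzero on it. *)
  have -> : idle (xi + t *: x) = [seq ab <- idle xi | (xi + t *: x) ab.1 != ab.2 :> R].
    rewrite -filter_predI; apply: eq_in_filter => ab abs /=.
    case: (eqVneq (xi ab.1 : R)) => [xiab|_]; rewrite ?andbT // andbF.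
    by have /actI/andP[_ ->] : active s xi ab by rewrite /active abs xiab eqxx.
  rewrite size_filter ltn_neqAle count_size andbT -all_count;
    apply/negP => /allP/(_ vc).
  rewrite mem_filter vcs andbT vc_eta eqxx => /(_ _)/negP; apply => //.
  apply/negP => /eqP xivc; have := xA vc;
    rewrite /active vcs xivc eqxx => /(_ isT) xvc0.
  by rewrite xvc0 ltxx in xvc.
by exists nu; split=> // ab /actI/nuA.
Qed.

(** The face of [face_active] works: on its affine hull the active constraints stay tight, and the
    idle ones survive in a small ball. *)
Lemma relint_face s xi : halfspaces s xi ->
  exists F, face (halfspaces s) F /\ relint F xi.
Proof.
move=> sxi; eexists; split; first exact: (face_active sxi).
split; first by split=> // vc /andP[_ /eqP].
have [|e e0 eP] := @seq_common_radius _ s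
  (fun vc e => (xi vc.1 : R) != vc.2 -> forall eta,
    dual_norm (eta - xi) <= e -> vc.2 <= (eta vc.1 : R)).
  move=> vc vcs; have [k k0 kP] := eval_le_dual_norm vc.1.
  have := sxi vc vcs; rewrite le_eqVlt => /orP[/eqP xivc|xivc].
    by exists 1 => // t' _ /eqP; rewrite -xivc.
  exists (((xi vc.1 : R) - vc.2) / k); first by rewrite divr_gt0 ?subr_gt0.
  move=> t' /andP[_ t'le] _ eta etat'; have := le_trans etat' t'le.
  rewrite ler_pdivlMr // mulrC => /(le_trans (kP _)).
  by rewrite sub_evalE ler_norml => /andP[+ _]; lra.
exists e => // eta [n [t [y [t1 yF ->]]]].
set z := \sum_(i < n) _ => ze.
have zA vc : active s xi vc -> z vc.1 = vc.2 :> R.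
  move=> vcA; rewrite sum_lfunE -[RHS]mul1r -t1 mulr_suml;
    apply: eq_bigr => i _.
  by rewrite scale_evalE; case: (yF i) => _ ->.
split=> // vc vcs; have [xivc|xivc] := eqVneq (xi vc.1 : R) vc.2.
  by rewrite zA // /active vcs xivc eqxx.
by apply: (eP vc vcs e) => //; rewrite ?lexx ?ltW.
Qed.

(** Whichever face [face_at] picks, its points can be pushed slightly past [xi], so an active
    constraint, minimal at [xi], is constant on it. The converse is [line_in_face]. *)
Lemma local_linP s xi x : halfspaces s xi ->
  (x \in local_lin (halfspaces s) xi) <->
  (forall vc, active s xi vc -> x vc.1 = 0 :> R).
Proof.
move=> sxi; rewrite /local_lin /face_at.
case: xgetP => [F _ [fF rF]|noF]; last first.
  by have [F FP] := relint_face sxi; case: (noF F).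
have [v [c [_ FE]]] := fF; have [Fxi [e e0 eP]] := rF.
have [FS _] := span_setP (translate F xi).
split=> [xF vc vcA|xA].
  have [n [b [y [yF ->]]]] := span_set_lincomb xF.
  rewrite sum_lfunE big1 // => i _; have [eta Feta <-] := yF i.
  rewrite scale_evalE; suff -> : (eta - xi) vc.1 = 0 :> R by rewrite mulr0.
  have [t t0 tle] := dual_norm_small (- (eta - xi)) e0.
  have Fm : F (xi + t *: - (eta - xi)).
    apply: eP; last by rewrite addrC addKr.
    exists 2%N, (fun i => if i == 0 then 1 + t else - t),
      (fun i => if i == 0 then xi else eta).
    split=> [|k|]; first by rewrite big_ord_recl big_ord1 /= addrK.
      by case: ifP.
    by rewrite big_ord_recl big_ord1 /= scalerDl scale1r opprB scalerBr scaleNr addrA.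
  have [/(_ vc) ge_eta _] : halfspaces s eta /\ eta v = c by move: Feta;
    rewrite FE.
  have [/(_ vc) ge_m _] : halfspaces s (xi + t *: - (eta - xi)) /\
    (xi + t *: - (eta - xi)) v = c.
    by move: Fm; rewrite FE.
  case/andP: vcA => vcs /eqP xivc; move: (ge_eta vcs) (ge_m vcs).
  rewrite line_evalE opp_lfunE sub_evalE xivc => h1 h2.
  have : 0 <= t * - ((eta vc.1 : R) - vc.2) by lra.
  by rewrite pmulr_rge0 // => h3; lra.
have [t t0 Ft] := line_in_face sxi fF Fxi xA.
have : t *: x \in span_set (translate F xi).
  by apply: FS; exists (xi + t *: x); last by rewrite addrC addKr.
by move=> /(memvZ t^-1); rewrite scalerA mulVf ?scale1r ?gt_eqF.
Qed.

End Polyhedra.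

(** * Transverse intersections of polytopes *)

Section LocalFrames.
Variables (R : realType) (g : vectType R).
Local Notation gd := 'Hom(g, R^o).
Implicit Types (s : seq (g * R)) (x xi nu : gd) (D : set gd).
Implicit Types (Lam : set gd) (K : set R).

Definition adapted_at_vertices Lam K D : Prop := forall nu, vertex D nu ->
  exists n (X : n.-tuple gd), adapted_basis Lam K (local_cone D nu) X.

(* The frame at [xi] consists of the generators of the local cone at a vertex
   [nu] of the face of [xi] which do not occur in the positive combination
   [xi - nu]; the others span the tangent space of that face. *)
Lemma local_frame s Lam K xi : halfspaces s xi -> bounded (halfspaces s) ->
  adapted_at_vertices Lam K (halfspaces s) ->
  exists (J : finType) (e : J -> gd), frame Lam K (local_cone (halfspaces s) xi)
    (dir (halfspaces s)) (local_lin (halfspaces s) xi) e.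
Proof.
move=> sxi bs adapted; set L := local_lin _ _; set C := local_cone _ xi.
have [nu [snu vnu nuA]] := exists_vertex sxi bs.
have [n [X [CnuE freeX LamX KX]]] := adapted nu vnu.
have CnuP := local_cone_halfspaces snu; have CP : C = _ :=
  local_cone_halfspaces sxi.
have [a a0 aE] : exists2 a : 'I_n -> R, (forall i, 0 <= a i) &
    xi - nu = \sum_(i < n) a i *: X`_i.
  by apply/cone_hull_tuple; rewrite -CnuE; apply: sub_cone_hull; exists xi.
have uniqX (c d : 'I_n -> R) :
    \sum_(i < n) c i *: X`_i = \sum_(i < n) d i *: X`_i -> forall i, c i = d i.
  move=> /eqP; rewrite -subr_eq0 -sumrB => /eqP cd i; apply/eqP;
    rewrite -subr_eq0.
  apply/eqP; apply: (freeP freeX (fun i => c i - d i)).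
  by rewrite -[RHS]cd; apply: eq_bigr => k _; rewrite scalerBl.
have X_ge0 (i : 'I_n) vc : active s nu vc -> 0 <= (X`_i vc.1 : R).
  suff : local_cone (halfspaces s) nu X`_i by rewrite CnuP; apply.
  by rewrite CnuE; apply: sub_cone_hull; rewrite /= mem_nth ?size_tuple.
(* A constraint active at [xi] is active at [nu], hence nonnegative on all generators, and it
   vanishes on [xi - nu]; so it vanishes on each generator with positive coefficient. *)
have XL (i : 'I_n) : 0 < a i -> X`_i \in L.
  move=> ai0; apply/(local_linP _ sxi) => vc vcA.
  have /eqP : (xi - nu) vc.1 = 0 :> R.
    rewrite sub_evalE; case/andP: (nuA _ vcA) => _ /eqP ->.
    by case/andP: vcA => _ /eqP ->; rewrite subrr.
  rewrite aE sum_lfunE psumr_eq0 => [/allP/(_ i (mem_index_enum _))|k _].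
    by rewrite scale_evalE mulf_eq0 gt_eqF //= => /eqP.
  by rewrite scale_evalE mulr_ge0 // X_ge0 // nuA.
(* A short step [xi + t *: x] has nonnegative coefficients [c] as seen from [nu]; those of [x] are
   [(c - a) / t], nonnegative where [a] vanishes. *)
have conic x : C x -> exists2 d : 'I_n -> R,
    x = \sum_(i < n) d i *: X`_i & forall i, ~~ (0 < a i) -> 0 <= d i.
  rewrite CP => xpos; have [t t0 /(_ t)] := line_in_halfspaces sxi xpos.
  rewrite lexx ltW // => /(_ isT) sx.
  have [c c0 cE] : exists2 c : 'I_n -> R, (forall i, 0 <= c i) &
      (xi + t *: x) - nu = \sum_(i < n) c i *: X`_i.
    by apply/cone_hull_tuple; rewrite -CnuE; apply: sub_cone_hull;
      exists (xi + t *: x).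
  exists (fun i => t^-1 * (c i - a i)) => [|i].
    have -> : x = t^-1 *: (t *: x) by rewrite scalerA mulVf ?scale1r ?gt_eqF.
    have -> : t *: x = \sum_(i < n) c i *: X`_i - \sum_(i < n) a i *: X`_i.
      by rewrite -cE -aE opprB addrA subrK addrC addKr.
    rewrite -sumrB scaler_sumr; apply: eq_bigr => i _.
    by rewrite -scalerBl scalerA.
  rewrite -leNgt => ai; have -> : a i = 0 by apply/eqP; rewrite eq_le ai a0.
  by rewrite subr0 mulr_ge0 // invr_ge0 ltW.
pose A : {pred 'I_n} := [pred i | ~~ (0 < a i)].
pose J : finType := {i : 'I_n | i \in A}; pose e (j : J) := X`_(val j).
have modL (c : 'I_n -> R) :
    \sum_(i < n) c i *: X`_i - \sum_(j : J) c (val j) *: e j \in L.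
  rewrite -(big_sub A (fun i => c i *: X`_i)) (bigID (mem A)) /= addrAC subrr add0r.
  by apply: memv_suml => i /negPn ai; apply/memvZ/XL.
(* Extension of the coefficients by 0 outside [A]. *)
have ext (c : J -> R) : exists2 c' : 'I_n -> R, (forall j, c' (val j) = c j) &
    \sum_j c j *: e j = \sum_(i < n) c' i *: X`_i.
  exists (fun i => if (insub i : option J) is Some j then c j else 0) => [j|];
    first by rewrite valK.
  rewrite [RHS](bigID (mem A)) /= [X in _ = _ + X]big1 ?addr0 => [|i iA];
    last first.
    by case: (insubP J i) => [j|]; rewrite ?scale0r // (negPf iA).
  rewrite [RHS]big_sub; apply: eq_bigr => j _.
  by rewrite valK.
have LC x : x \in L -> C x.
  by move=> /(local_linP _ sxi) xA; rewrite CP => vc /xA ->.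
(* [L] is a linear space inside [C], so the sum and its negative both have nonnegative coefficients
   on [J]. *)
have efree (c : J -> R) : \sum_j c j *: e j \in L -> forall j, c j = 0.
  move=> cL j; have [c' c'E sE] := ext c.
  have [d dE d0] := conic _ (LC _ cL).
  have cLN : - (\sum_j c j *: e j) \in L by rewrite memvN.
  have [d' d'E d'0] := conic _ (LC _ cLN).
  have jA : ~~ (0 < a (val j)) := valP j.
  have c'd : c j = d (val j) by rewrite -c'E; apply: uniqX; rewrite -sE.
  have c'd' : - c j = d' (val j).
    rewrite -c'E; apply: (uniqX (fun i => - c' i)); rewrite -d'E sE -sumrN.
    by apply: eq_bigr => i _; rewrite scaleNr.
  by apply/eqP; rewrite eq_le -oppr_ge0 c'd' c'd d0 ?d'0.
have dirX : dir (halfspaces s) = <<X>>%VS.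
  by rewrite -(dir_local_cone snu) -/(local_cone _ _) CnuE dir_cone_hull span_set_span.
exists J, e; split=> [x|j|j|//|c x Lx xL j].
- split=> [/conic[d dE d0]|[c c0 xL]].
    exists (fun j => d (val j)) => [j|]; first exact/d0/(valP j).
    by rewrite {1}dE modL.
  rewrite CP /= => vc vcA; move/(local_linP _ sxi)/(_ _ vcA): xL.
  rewrite sub_evalE => /eqP; rewrite subr_eq0 => /eqP ->.
  rewrite sum_lfunE; apply: sumr_ge0 => j _.
  by rewrite scale_evalE mulr_ge0 // X_ge0 // nuA.
- by rewrite dirX memv_span // mem_nth ?size_tuple.
- exact: LamX.
(* The coefficients [d0 + c'] of [x] lie in [K] because [x] is in [Lam]; comparing modulo [L],
   [efree] shows that on [J] they agree with [c]. *)
- have [d0 d0E _] := conic _ (LC _ xL); have [c' _ c'E] := ext c.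
  have xE : x = \sum_(i < n) (d0 i + c' i) *: X`_i.
    rewrite -[LHS](subrK (\sum_j c j *: e j)) {1}d0E c'E -big_split /=.
    by apply: eq_bigr => i _; rewrite scalerDl.
  have Kd : K (d0 (val j) + c' (val j)) by move: Lx; rewrite xE => /KX.
  suff /eqP : (d0 (val j) + c' (val j)) - c j = 0
    by rewrite subr_eq0 => /eqP <-.
  apply: (efree (fun j => d0 (val j) + c' (val j) - c j)).
  have -> : \sum_(j : J) (d0 (val j) + c' (val j) - c j) *: e j =
      (x - \sum_j c j *: e j) - (x - \sum_(j : J) (d0 (val j) + c' (val j)) *: e j).
    rewrite opprB addrC addrA subrK -sumrB.
    by apply: eq_bigr => k _; rewrite scalerBl.
  by rewrite rpredB // {1}xE (modL (fun i => d0 i + c' i)).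
Qed.

Lemma halfspaces_cat s1 s2 : halfspaces s1 `&` halfspaces s2 = halfspaces (s1 ++ s2).
Proof.
apply/seteqP; split=> x.
  by move=> [s1x s2x] vc; rewrite mem_cat => /orP[/s1x|/s2x].
by move=> sx; split=> vc vcs; apply: sx; rewrite mem_cat vcs ?orbT.
Qed.

Lemma active_cat s1 s2 xi vc : active (s1 ++ s2) xi vc = active s1 xi vc || active s2 xi vc.
Proof. by rewrite /active mem_cat andb_orl. Qed.

Lemma vertex_mem D xi : vertex D xi -> D xi.
Proof. by move=> [v [c [_ xiE]]]; have : [set xi] xi by []; rewrite xiE => -[].
Qed.

(** A constraint is active for the intersection when it is active for either polytope, so local
    cones intersect. At a vertex only 0 annihilates all active normals, so the tangent spaces meet
    in 0 and [frame_setI] applies. *)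
Lemma adapted_setI Lam K D1 D2 :
  (forall x y, Lam x -> Lam y -> Lam (x - y)) ->
  polytope D1 -> polytope D2 ->
  adapted_at_vertices Lam K D1 -> adapted_at_vertices Lam K D2 ->
  (forall xi x, (D1 `&` D2) xi -> Lam x -> x \in dir D1 \/ x \in dir D2 ->
     exists l, [/\ Lam l, l \in local_lin D1 xi & x - l \in local_lin D2 xi]) ->
  adapted_at_vertices Lam K (D1 `&` D2).
Proof.
move=> LamB [[s1 ->] b1] [[s2 ->] b2] A1 A2 transverse xi vxi.
have [s1xi s2xi] := vertex_mem vxi.
have sxi : halfspaces (s1 ++ s2) xi by rewrite -halfspaces_cat.
have -> : local_cone (halfspaces s1 `&` halfspaces s2) xi =
    local_cone (halfspaces s1) xi `&` local_cone (halfspaces s2) xi.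
  rewrite halfspaces_cat !local_cone_halfspaces //; apply/seteqP; split=> x /=.
    by move=> xA; split=> vc vcA; apply: xA; rewrite active_cat vcA ?orbT.
  by move=> [x1 x2] vc; rewrite active_cat => /orP[/x1|/x2].
have [J1 [e1 F1]] := local_frame s1xi b1 A1; have [J2 [e2 F2]] :=
  local_frame s2xi b2 A2.
have L12 : (local_lin (halfspaces s1) xi :&: local_lin (halfspaces s2) xi = 0)%VS.
  apply/eqP; rewrite -subv0; apply/subvP => x; rewrite memv_cap memv0.
  move=> /andP[/(local_linP _ s1xi) x1 /(local_linP _ s2xi) x2]; apply/eqP.
  apply: (vertex_lineality sxi); first by rewrite -halfspaces_cat.
  by move=> vc; rewrite active_cat => /orP[/x1|/x2].
have [|J [w F]] := frame_setI LamB F1 F2 L12.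
  by move=> x; apply: transverse.
by exists #|J|, (codom_tuple w); apply: frame_adapted_basis F.
Qed.

(** * Simple and unimodular cones in terms of adapted bases *)

Lemma simple_coneP (C : set gd) : simple_cone C <->
  polyhedron C /\ exists n (X : n.-tuple gd), adapted_basis setT setT C X.
Proof.
split=> [[pC [X /andP[_ freeX] CE]]|[pC [n [X [CE freeX _ _]]]]]; split=> //.
  by exists (size X), (in_tuple X); split.
by exists X => //; rewrite /basis_of CE dir_cone_hull span_set_span eqxx.
Qed.

Lemma dual_latticeB (gZ : set g) x y :
  dual_lattice gZ x -> dual_lattice gZ y -> dual_lattice gZ (x - y).
Proof. by move=> Zx Zy v gv; rewrite sub_evalE rpredB ?Zx ?Zy. Qed.

Lemma dual_lattice0 (gZ : set g) : dual_lattice gZ 0.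
Proof. by move=> v _; rewrite zero_lfunE rpred0. Qed.

(* Integer matrices have the same rank over the rationals and over the reals. *)
Lemma dual_lattice_free gZ n (X : n.-tuple gd) : is_lattice gZ ->
  (forall i : 'I_n, dual_lattice gZ X`_i) ->
  (forall a : 'I_n -> int, \sum_(i < n) X`_i *~ a i = 0 -> forall i, a i = 0) ->
  free X.
Proof.
move=> [m [B [/andP[/eqP spanB freeB] ->]]] ZX indep.
have XB (i : 'I_n) (k : 'I_m) : (X`_i B`_k : R) \is a Num.int.
  by apply: (ZX i B`_k); apply: inIntSpan_nth.
(* The integer pairings of [X] with the lattice basis [B], stored as rationals. *)
pose M : 'M[rat]_(n, m) := \matrix_(i, k) (Num.floor (X`_i B`_k : R))%:~R.
have ME (i : 'I_n) (k : 'I_m) : ratr (M i k) = (X`_i B`_k : R)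
  by rewrite mxE ratr_int floorK.
have rfM : row_free M.
  apply: inj_row_free => v vM.
  (* A common denominator, turning a rational relation into an integral one. *)
  pose d : int := \prod_i denq (v 0 i).
  have clear_denq i : exists z : int, z%:~R = d%:~R * v 0 i.
    exists (numq (v 0 i) * \prod_(k | k != i) denq (v 0 k)).
    by rewrite /d [in RHS](bigD1 i) //= !rmorphM /= numqE; ring.
  have [z zE] := choice clear_denq.
  have z0 : \sum_(i < n) X`_i *~ z i = 0.
    apply/lfunP => u; rewrite zero_lfunE.
    have uB : u \in <<B>>%VS by rewrite spanB memvf.
    rewrite (coord_span uB) eval_lincomb big1 // => k _.
    suff -> : (\sum_(i < n) X`_i *~ z i) B`_k = 0 :> R by rewrite mulr0.
    rewrite sum_lfunE (eq_bigr (fun i => ratr ((z i)%:~R * M i k) : R)).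
      rewrite -rmorph_sum (eq_bigr (fun i => d%:~R * (v 0 i * M i k))).
        rewrite -mulr_sumr; move/matrixP/(_ 0 k): vM; rewrite !mxE => ->.
        by rewrite mulr0 rmorph0.
      by move=> i _; rewrite zE mulrA.
    move=> i _; rewrite rmorphM /= ME ratr_int -scaler_int scale_evalE //.
  apply/rowP => i; rewrite mxE; apply/eqP.
  have /eqP := zE i; rewrite (indep _ z0) eq_sym mulf_eq0 intr_eq0 => /orP[|//].
  by rewrite /d => /prodf_eq0[k _]; rewrite denq_eq0.
(* Evaluated on [B], a real relation lies in the left kernel of [M] over the reals, where [M] is
   still row free. *)
apply/freeP => c cX i.
have : \row_k c k *m map_mx (ratr : rat -> R) M == 0.
  apply/eqP/rowP => k; rewrite !mxE.
  have cXk : (\sum_(i < n) c i *: X`_i) B`_k = 0 :> R by rewrite cX zero_lfunE.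
  rewrite -[RHS]cXk sum_lfunE; apply: eq_bigr => j _.
  by rewrite scale_evalE -ME !mxE.
rewrite mulmx_free_eq0 ?row_free_map // => /eqP/rowP/(_ i).
by rewrite !mxE.
Qed.

(** Forward, Z-independence gives real independence by [dual_lattice_free], so the real coefficients
    of a lattice point are its integral ones. Backward, the coordinates of a lattice point are
    integers, recovered by [Num.floor]. *)
Lemma unimodular_coneP gZ (C : set gd) : is_lattice gZ ->
  unimodular_cone gZ C <->
  Defs.rational gZ C /\ exists n (X : n.-tuple gd),
    adapted_basis (dual_lattice gZ) [set r : R | r \is a Num.int] C X.
Proof.
move=> latZ; split=> -[rC [n [X]]].
  move=> [[ZE indep] CE]; split=> //; exists n, X.
  have XZ (i : 'I_n) : lattice_in gZ (dir C) X`_i by rewrite ZE;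
    apply: inIntSpan_nth.
  have freeX : free X.
    by apply: (dual_lattice_free latZ) indep => i; case: (XZ i).
  split=> // [i|c cZ i]; first by case: (XZ i).
  have : lattice_in gZ (dir C) (\sum_(i < n) c i *: X`_i).
    by split=> //=; apply: memv_suml => k _; apply: memvZ; case: (XZ k).
  rewrite ZE => -[a] /eqP; rewrite -subr_eq0 sum_intz -sumrB => /eqP ca.
  have /eqP : c i - (a i)%:~R = 0.
    apply: (freeP freeX (fun i => c i - (a i)%:~R)).
    by rewrite -[RHS]ca; apply: eq_bigr => k _; rewrite scalerBl.
  by rewrite subr_eq0 => /eqP -> /=; apply: intr_int.
move=> [CE freeX XZ XK]; split=> //; exists n, X; split=> //.
have dirX : dir C = <<X>>%VS by rewrite CE dir_cone_hull span_set_span.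
split=> [|a]; last first.
  by rewrite sum_intz => /(freeP freeX) a0 i; have /eqP := a0 i;
    rewrite intr_eq0 => /eqP.
apply/seteqP; split=> x /=.
  rewrite dirX => -[xZ /= /coord_span xE].
  have cK i : coord X i x \is a Num.int.
    by apply: (XK (fun i => coord X i x)); rewrite -xE.
  exists [ffun i => Num.floor (coord X i x)]; rewrite {1}xE.
  by apply: eq_bigr => i _; rewrite ffunE -scaler_int floorK.
move=> [a ->]; rewrite sum_intz; split=> /=.
  move=> v gv; rewrite sum_lfunE; apply: rpred_sum => i _.
  by rewrite scale_evalE rpredM ?intr_int ?(XZ i v gv).
by rewrite dirX; apply: memv_suml => i _;
  rewrite memvZ // memv_span // mem_nth ?size_tuple.
Qed.

(** * Passage of each property to the intersection *)

Lemma polytope_setI D1 D2 : polytope D1 -> polytope D2 -> polytope (D1 `&` D2).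
Proof.
move=> [[s1 ->] [M1 b1]] [[s2 ->] _]; split; last by exists M1 => x [/b1].
by exists (s1 ++ s2); rewrite halfspaces_cat.
Qed.

Lemma rational_setI gZ D1 D2 : Defs.rational gZ D1 -> Defs.rational gZ D2 ->
  Defs.rational gZ (D1 `&` D2).
Proof.
move=> [s1 s1Z ->] [s2 s2Z ->]; exists (s1 ++ s2); last
  by rewrite halfspaces_cat.
by move=> vc; rewrite mem_cat => /orP[/s1Z|/s2Z].
Qed.

Lemma polyhedron_local_cone D xi : D xi -> polyhedron D ->
  polyhedron (local_cone D xi).
Proof. by move=> Dxi [s DE]; rewrite DE in Dxi *;
  rewrite local_cone_halfspacesE //; eexists. Qed.

Lemma rational_local_cone gZ D xi : D xi -> Defs.rational gZ D ->
  Defs.rational gZ (local_cone D xi).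
Proof.
move=> Dxi [s sZ DE]; rewrite DE in Dxi *; rewrite local_cone_halfspacesE //;
  eexists; last by [].
by move=> p /mapP[vc]; rewrite mem_filter => /andP[_ /sZ] + ->.
Qed.

Lemma simple_polytope_setI D1 D2 : simple_polytope D1 -> simple_polytope D2 ->
  relatively_transverse D1 D2 -> simple_polytope (D1 `&` D2).
Proof.
move=> [p1 v1] [p2 v2] transverse.
have p12 := polytope_setI p1 p2; split=> // xi vxi; apply/simple_coneP; split.
  by apply: polyhedron_local_cone (vertex_mem vxi) _; case: p12.
apply: (adapted_setI _ p1 p2) vxi => //.
- by move=> nu /v1/simple_coneP[].
- by move=> nu /v2/simple_coneP[].
- move=> eta x /transverse LE _ xD.
  have : x \in (dir D1 + dir D2)%VS.
    by case: xD; apply/subvP; rewrite ?addvSl ?addvSr.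
  rewrite -LE => /memv_addP[l1 l1L [l2 l2L ->]]; exists l1.
  by split; rewrite // addrC addKr.
Qed.

Lemma unimodular_polytope_setI gZ D1 D2 : is_lattice gZ ->
  unimodular_polytope gZ D1 -> unimodular_polytope gZ D2 ->
  integrally_transverse gZ D1 D2 -> unimodular_polytope gZ (D1 `&` D2).
Proof.
move=> latZ [p1 r1 v1] [p2 r2 v2] transverse.
have r12 := rational_setI r1 r2.
split=> [||xi vxi];
  [exact: polytope_setI|by []|apply/(unimodular_coneP _ latZ); split].
  exact: rational_local_cone (vertex_mem vxi) r12.
apply: (adapted_setI _ p1 p2) vxi.
- exact: dual_latticeB.
- by move=> nu /v1/(unimodular_coneP _ latZ)[].
- by move=> nu /v2/(unimodular_coneP _ latZ)[].
- move=> eta x /transverse LE Zx xD.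
  have Z0 : dual_lattice gZ 0 by exact: dual_lattice0.
  (* A lattice vector of one direction space is itself plus 0. *)
  have : sumset (lattice_in gZ (dir D1)) (lattice_in gZ (dir D2)) x.
    case: xD => xD; first by exists x => //; exists 0; rewrite ?addr0 //;
      split=> //=; apply: mem0v.
    by exists 0; [split=> //=; apply: mem0v|exists x; rewrite ?add0r].
  rewrite -LE => -[l1 [Zl1 l1L] [l2 [_ l2L] <-]]; exists l1.
  by split; rewrite // addrC addKr.
Qed.

End LocalFrames.

Theorem corollaryA27 (R : realType) (g : vectType R) (gZ : set g)
    (D1 D2 : set 'Hom(g, R^o)) :
  is_lattice gZ -> polytope D1 -> polytope D2 -> D1 `&` D2 !=set0 ->
  (simple_polytope D1 -> simple_polytope D2 -> relatively_transverse D1 D2 ->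
     simple_polytope (D1 `&` D2)) /\
  (unimodular_polytope gZ D1 -> unimodular_polytope gZ D2 ->
     integrally_transverse gZ D1 D2 ->
     unimodular_polytope gZ (D1 `&` D2)).
Proof.
move=> latZ _ _ _; split; first exact: simple_polytope_setI.
exact: unimodular_polytope_setI.
Qed.
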